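(* Let $T$ be an embedded plane tropical curve with dual subdivision $S_T$ of its Newton polygon $\Delta$. Let $\delta_1,\dots,\delta_k$ be all the triangles and parallelograms of $S_T$ and let $\delta_{k+1},\dots,\delta_l$ be all the other polygons of $S_T$, listed in any order. Then $$rk(T)\le\#Vert(S_T)-1-\sum_{\delta\in\{\delta_1,\dots,\delta_k\}}(\#Vert(\delta)-3)-\sum_{i=k+1}^{l}\Big(\#Vert(\delta_i)-\max\Big\{3,\ \#\Big(Vert(\delta_i)\cap\bigcup_{j<i}Vert(\delta_j)\Big)\Big\}\Big).$$
   Context: An embedded plane tropical curve $T$ is the corner locus of $\max_{\omega\in\Delta\cap\mathbb{Z}^2}(\langle\omega,x\rangle+c_\omega)$, $x\in\mathbb{R}^2$, with Newton polygon $\Delta$; $S_T$ is the dual subdivision (the regular subdivision of $\Delta$ induced by $\omega\mapsto c_\omega$), $Vert(S_T)$ its vertex set and $Vert(\delta)$ the vertex set of a polygon $\delta$. The rank $rk(T)$ is the dimension of the set of vectors $(c_\omega)_{\omega\in Vert(S_T)}$, modulo adding a common constant, that induce exactly the subdivision $S_T$ (the space of curves with the same dual subdivision). *)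

(* Defs.v *)
From HB Require Import structures.
From Stdlib Require Import ClassicalEpsilon.
From mathcomp Require Import all_boot all_order all_algebra.
Set Implicit Arguments. Unset Strict Implicit. Unset Printing Implicit Defensive.
Import Order.TTheory GRing.Theory Num.Theory.
Local Open Scope ring_scope.

Definition asbool (P : Prop) : bool :=
  if excluded_middle_informative P then true else false.

(* Setting: lattice points p i (i : 'I_n, p injective) carry coefficients
   c i; the tropical polynomial is  x |-> max_i (<p i, x> + c i).  Only the
   points of a support set W are used (W = setT for the curve T itself). *)
Section Trop.
Variables (R : realFieldType) (n : nat) (p : 'I_n -> int * int).

Definition dotp (u : R * R) (w : int * int) : R :=
  (w.1)%:~R * u.1 + (w.2)%:~R * u.2.

Definition monval (c : 'I_n -> R) (x : R * R) (i : 'I_n) : R := dotp x (p i) + c i.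

Definition maxset (W : {set 'I_n}) (c : 'I_n -> R) (x : R * R) : {set 'I_n} :=
  [set i in W | [forall j in W, monval c x j <= monval c x i]].

Definition cross (a b d : int * int) : int :=
  (b.1 - a.1) * (d.2 - a.2) - (b.2 - a.2) * (d.1 - a.1).

Definition collinear (S : {set 'I_n}) : bool :=
  [forall i in S, forall j in S, forall k in S, cross (p i) (p j) (p k) == 0].

Definition is_vert (S : {set 'I_n}) (i : 'I_n) : Prop :=
  i \in S /\ exists u : R * R, forall j, j \in S -> j != i -> dotp u (p j) < dotp u (p i).

(* V is the vertex set of a polygon (2-cell) of the regular subdivision
   induced by c on the points of W: the cells are conv(p(maxset W c x)). *)
Definition cell_polygon (W : {set 'I_n}) (c : 'I_n -> R) (V : {set 'I_n}) : Prop :=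
  exists x : R * R, ~~ collinear (maxset W c x) /\
    (forall i, i \in V <-> is_vert (maxset W c x) i).

Definition subdiv_verts (c : 'I_n -> R) : {set 'I_n} :=
  [set i | asbool (exists x : R * R, forall j, j != i -> monval c x j < monval c x i)].

Definition subdiv_polys (c : 'I_n -> R) : {set {set 'I_n}} :=
  [set V | asbool (cell_polygon setT c V)].

Definition is_parallelogram (V : {set 'I_n}) : bool :=
  (#|V| == 4)%N &&
  [exists a in V, exists b in V, exists d in V, exists e in V,
    [&& a != b, a != d, a != e, b != d, b != e, d != e,
        (p a).1 + (p d).1 == (p b).1 + (p e).1 &
        (p a).2 + (p d).2 == (p b).2 + (p e).2]].

Definition tri_or_par (V : {set 'I_n}) : bool := ((#|V| == 3)%N || is_parallelogram V).

Definition same_subdiv_vectors (c : 'I_n -> R) (v : 'rV[R]_n) : Prop :=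
  exists c' : 'I_n -> R,
    (forall V, cell_polygon setT c V <-> cell_polygon (subdiv_verts c) c' V) /\
    v = \row_i (if i \in subdiv_verts c then c' i else 0).

(* dimension of the image of a set S of vectors modulo the line spanned by
   `one`: for finitely many points v_0..v_m of S, the rank of the span of
   the differences v_k - v_0 together with `one`, minus 1; maximised. *)
Definition dim_attained (S : 'rV[R]_n -> Prop) (one : 'rV[R]_n) (k : nat) : Prop :=
  exists (m : nat) (vs : 'I_m.+1 -> 'rV[R]_n), (forall i, S (vs i)) /\
    \rank (col_mx (\matrix_(j < m) (vs (lift ord0 j) - vs ord0)) one) = k.

Definition dim_mod (S : 'rV[R]_n -> Prop) (one : 'rV[R]_n) : int :=
  (\max_(k < n.+1 | asbool (dim_attained S one k)) (k : nat))%:Z - 1.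

Definition trop_rank (c : 'I_n -> R) : int :=
  dim_mod (same_subdiv_vectors c)
          (\row_i (if i \in subdiv_verts c then 1 else 0)).

End Trop.

(* Main.v *)
Require Import Defs.
From HB Require Import structures.
From mathcomp Require Import all_boot all_order all_algebra.
From mathcomp Require Import ring lra zify.
Import Order.TTheory GRing.Theory Num.Theory.
Local Open Scope ring_scope.

(* A cell V of the subdivision is dual to a point x_V, and a vector inducing the
   same subdivision is affine on V; three vertices of V are never collinear, so
   V imposes #V - 3 linear conditions.  Going through the cells one by one, the
   vertices of V not met before provide at least #V - max(3, #(old vertices))
   new pivots, which bounds the rank.  For the parallelograms to contribute one
   pivot each, order them by increasing <x_V, (1, t)> with t generic: if
   (1, t) = a (v - q) + b (v - r) with a, b > 0 and v, q, r vertices of V, then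
   concavity of the lift gives <x_V, (1, t)> < <x_W, (1, t)> for every other
   cell W containing v, so v is on no earlier parallelogram. *)

Set Implicit Arguments.
Unset Strict Implicit.
Unset Printing Implicit Defensive.

Lemma asboolP (P : Prop) : reflect P (asbool P).
Proof.
rewrite /asbool; case: ClassicalEpsilon.excluded_middle_informative => h.
  exact: ReflectT.
exact: ReflectF.
Qed.

(** * Counting pivots along a list of sets *)

Section Excess.
Variable T : finType.
Implicit Types (U V W Z P : {set T}) (s : seq {set T}).

(** Number of pivots guaranteed when the sets of [s] are met in turn, [U] collecting the elements
    met before. The subtraction is truncated, so no term is negative. *)
Fixpoint excess U s : nat :=
  if s is V :: s' then (#|V| - maxn 3 #|V :&: U|) + excess (U :|: V) s' else 0.

Lemma excess_cat U s1 s2 :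
  excess U (s1 ++ s2) = (excess U s1 + excess (U :|: \bigcup_(V <- s1) V) s2)%N.
Proof.
elim: s1 U => [|V s1 IH] U /=; first by rewrite big_nil setU0.
by rewrite IH big_cons setUA addnA.
Qed.

Lemma excess_nth U s :
  excess U s = (\sum_(i < size s)
    (#|nth set0 s i| - maxn 3 #|nth set0 s i :&: (U :|: \bigcup_(j < i) nth set0 s j)|))%N.
Proof.
elim: s U => [|V s IH] U /=; first by rewrite big_ord0.
rewrite big_ord_recl /= big_ord0 setU0 IH; congr addn.
by apply: eq_bigr => i _; rewrite big_ord_recl /= setUA.
Qed.

(** Every set met before [V] has height at most [h V], whereas all other sets through the marked
    element [v] are strictly higher. So [v] is new, at most three elements of [V] are old, and the
    maximum with 3 is 3. *)
Lemma excess_fresh (R : realFieldType) (h : {set T} -> R) U s :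
  uniq s -> pairwise (fun W V => h W <= h V) s ->
  {in s, forall V, #|V| = 4 /\
     exists v, [/\ v \in V, v \notin U &
       {in s, forall W, W != V -> v \in W -> h V < h W}]} ->
  excess U s = (\sum_(V <- s) (#|V| - 3))%N.
Proof.
elim: s U => [|V s IH] U /=; first by rewrite big_nil.
case/andP=> Vs us /andP[/allP hV hp] hs; rewrite big_cons.
have [cV [v [vV vU _]]] := hs V (mem_head _ _).
rewrite (IH (U :|: V)) // => [|W Ws].
  congr addn; rewrite cV.
  have : (#|V :&: U| < #|V|)%N.
    apply: proper_card; rewrite properE subsetIl /=.
    by apply/subsetPn; exists v; rewrite // inE negb_and vU orbT.
  by rewrite cV ltnS => /maxn_idPl ->.
have WV : W != V by apply: contraNneq Vs => <-.
have [|cW [w [wW wU hw]]] := hs W; first by rewrite inE Ws orbT.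
split=> //; exists w; split=> // [|W' W's].
  rewrite inE negb_or wU; apply/negP => wV.
  by have := hw V (mem_head _ _); rewrite eq_sym WV wV => /(_ isT isT); rewrite ltNge hV.
by apply: hw; rewrite inE W's orbT.
Qed.

(* [P] is the set of pivots of a triangular system: going through [s], the
   elements of V outside the earlier sets and in excess of three known elements
   of V are forced.  [Z] stands for the zero set of a vector. *)
Lemma excess_pivots U s : exists P,
  [/\ P \subset ~: U, P \subset \bigcup_(V <- s) V, #|P| = excess U s &
    forall Z, {in s, forall V, 3 <= #|V :&: Z| -> V \subset Z}%N ->
      ~: P \subset Z -> P \subset Z].
Proof.
elim: s U => [|V s IH] U.
  by exists set0; split; rewrite /= ?sub0set ?cards0 // => Z _ _; apply: sub0set.
have [P [dP sP cP hP]] := IH (U :|: V).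
set k := (#|V| - maxn 3 #|V :&: U|)%N.
have /card_geqP[l [ul sl lV]] : (k <= #|V :\: U|)%N.
  by rewrite /k cardsD leq_sub2l // leq_maxr.
pose K := [set x in l].
have cK : #|K| = k by rewrite cardsE (card_uniqP ul).
have KVU : K \subset V :\: U by apply/subsetP => x; rewrite inE => /lV.
have KV : K \subset V := subset_trans KVU (subsetDl _ _).
have KU : K \subset ~: U by apply: subset_trans KVU _; rewrite setDE subsetIr.
have /andP[PU PV] : (P \subset ~: U) && (P \subset ~: V) by rewrite -subsetI -setCU.
have VP : V \subset ~: P by rewrite -setCS setCK.
exists (K :|: P); split.
- by rewrite subUset KU.
- by rewrite big_cons; apply: setUSS.
- rewrite /= -/k -cP -cK cardsU disjoint_setI0 ?cards0 ?subn0 //.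
  by rewrite disjoints_subset (subset_trans KV).
move=> Z hZ hKP.
(* The later pivots avoid [V], so an element of [V] outside [K] is no pivot at all. *)
have VKZ : V :\: K \subset Z.
  by apply: subset_trans hKP; rewrite setCU setIC setDE setSI.
have KZ : K \subset Z.
  (* With [k = 0] there is nothing to force. Otherwise the subtraction in [k] was not truncated, so
     [V :\: K] has exactly [maxn 3 #|V :&: U|] elements: at least three known zeros. *)
  have [k0|k0] := posnP k.
    by move: cK; rewrite k0 => /eqP; rewrite cards_eq0 => /eqP ->; apply: sub0set.
  apply: (subset_trans KV); apply: hZ; first exact: mem_head.
  apply: (@leq_trans #|V :\: K|); last first.
    by apply: subset_leq_card; rewrite subsetI subsetDl.
  rewrite cardsD (setIidPr KV) cK /k.
  by rewrite subKn ?leq_maxl // ltnW // -subn_gt0.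
rewrite subUset KZ /=; apply: hP => [W Ws|]; first by apply: hZ; rewrite inE Ws orbT.
apply/subsetP => x; rewrite inE => xP.
have [xK|xK] := boolP (x \in K); first exact: (subsetP KZ).
by apply: (subsetP hKP); rewrite in_setC in_setU negb_or xK.
Qed.

End Excess.

(** * Rank bound by coordinates, generic scalars and small scalars *)

Lemma mxrank_le_coords (F : fieldType) (m n : nat) (M : 'M[F]_(m, n)) (Q : {set 'I_n}) :
  (forall w : 'rV_n, (w <= M)%MS -> (forall j, j \in Q -> w 0 j = 0) -> w = 0) ->
  (\rank M <= #|Q|)%N.
Proof.
move=> h; pose B : 'M[F]_(n, #|Q|) := \matrix_(i, j) (i == enum_val j)%:R.
(* [B] projects onto the coordinates in [Q]; the hypothesis makes this projection injective on the
   row space of [M]. *)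
rewrite -(mxrank_mul_ker M B).
suff -> : (M :&: kermx B)%MS = 0 by rewrite mxrank0 addn0 rank_leq_col.
apply/eqP/rowV0P => v; rewrite sub_capmx => /andP[vM /sub_kermxP vB].
apply: h => // j jQ; move/rowP: vB => /(_ (enum_rank_in jQ j)).
rewrite !mxE (bigD1 j) //= mxE enum_rankK_in // eqxx mulr1 big1 ?addr0 //.
by move=> i ij; rewrite mxE enum_rankK_in // (negPf ij) mulr0.
Qed.

Lemma exists_notin (R : realFieldType) (s : seq R) : exists t, t \notin s.
Proof.
exists (1 + \sum_(x <- s) `|x|); set t := 1 + _; apply/negP => ts.
have : `|t| <= \sum_(x <- s) `|x|.
  by rewrite (big_rem t) //= lerDl sumr_ge0.
by have := ler_norm t; rewrite /t; lra.
Qed.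

(** Perturbation principle: [g] is a slack and [d] its rate of loss; a zero slack is allowed where
    the rate is negative. *)
Lemma exists_small (R : realFieldType) (T : finType) (g d : T -> R) :
  (forall j, 0 <= g j) -> (forall j, g j = 0 -> d j < 0) ->
  exists2 e, 0 < e & forall j, e * d j < g j.
Proof.
move=> g0 gd.
(* Asking for all smaller [e'] as well lets the induction take the minimum of two thresholds. *)
suff [e e0 he] : exists2 e, 0 < e & {in enum T, forall j e', 0 < e' <= e -> e' * d j < g j}.
  by exists e => // j; apply: he; rewrite ?mem_enum // e0 lexx.
elim: (enum T) => [|j s [e e0 he]]; first by exists 1.
have [e1 e10 he1] : exists2 e1, 0 < e1 & forall e', 0 < e' <= e1 -> e' * d j < g j.
  have [gj|gj] := eqVneq (g j) 0.
    exists 1 => // e' /andP[e'0 _]; rewrite gj pmulr_rlt0 //; exact: gd.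
  have gj0 : 0 < g j by rewrite lt_neqAle eq_sym gj g0.
  have d0 : 0 < 1 + `|d j| by rewrite ltr_pwDl.
  exists (g j / (1 + `|d j|)); first by rewrite divr_gt0.
  move=> e' /andP[e'0]; rewrite ler_pdivlMr // => h.
  have := ler_norm (d j); nra.
exists (Num.min e e1); first by rewrite lt_min e0 e10.
move=> i; rewrite inE => /predU1P[->|si] e' /andP[e'0]; rewrite le_min => /andP[h1 h2].
  by apply: he1; rewrite e'0.
by apply: he; rewrite ?e'0.
Qed.

(** * Plane geometry of the cells *)

Section Cells.
Variables (R : realFieldType) (n : nat) (p : 'I_n -> int * int).
Implicit Types (c : 'I_n -> R) (x u : R * R) (S V W : {set 'I_n}).

Notation px i := ((p i).1%:~R : R).
Notation py i := ((p i).2%:~R : R).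

Lemma crossR i j k :
  (cross (p i) (p j) (p k))%:~R =
  (px j - px i) * (py k - py i) - (py j - py i) * (px k - px i) :> R.
Proof. by rewrite /cross !(rmorphB, rmorphM). Qed.

(** Of three points on a line, one lies weakly between the other two, and no linear form has its
    strict maximum there. *)
Lemma verts_cross_neq0 S i j k :
  is_vert R p S i -> is_vert R p S j -> is_vert R p S k ->
  i != j -> i != k -> j != k -> cross (p i) (p j) (p k) != 0.
Proof.
move=> [iS [u hu]] [jS [v hv]] [kS [w hw]] ij ik jk.
rewrite -(intr_eq0 R) crossR; apply/eqP => cr0.
have := hu j jS; have := hu k kS; have := hv i iS; have := hv k kS.
have := hw i iS; have := hw j jS; rewrite (eq_sym j i) (eq_sym k i) (eq_sym k j) ij ik jk /dotp.
move=> /(_ isT) w1 /(_ isT) w2 /(_ isT) v1 /(_ isT) v2 /(_ isT) u1 /(_ isT) u2.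
pose d1 := px j - px i; pose d2 := py j - py i.
pose e1 := px k - px i; pose e2 := py k - py i.
have cr : d1 * e2 = d2 * e1 by move: cr0; rewrite /d1 /d2 /e1 /e2; lra.
(* The drops of [u] from [i] to [j] and to [k]. Both are positive, so [j] and [k] lie on the same
   side of [i], and comparing [D] with [E] tells which one is nearer; the form [v] or [w] peaking
   there gives the contradiction. *)
pose D := - (d1 * u.1 + d2 * u.2); pose E := - (e1 * u.1 + e2 * u.2).
have D0 : 0 < D by rewrite /D /d1 /d2; lra.
have E0 : 0 < E by rewrite /E /e1 /e2; lra.
have p1 : E * d1 = D * e1 by rewrite /D /E; ring: cr.
have p2 : E * d2 = D * e2 by rewrite /D /E; ring: cr.
have DE z : D * (e1 * z.1 + e2 * z.2) = E * (d1 * z.1 + d2 * z.2).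
  by rewrite !mulrDr !mulrA -p1 -p2.
have w3 : 0 < e1 * w.1 + e2 * w.2 by rewrite /e1 /e2; lra.
have w4 : d1 * w.1 + d2 * w.2 < e1 * w.1 + e2 * w.2 by rewrite /d1 /d2 /e1 /e2; lra.
have v3 : 0 < d1 * v.1 + d2 * v.2 by rewrite /d1 /d2; lra.
have v4 : e1 * v.1 + e2 * v.2 < d1 * v.1 + d2 * v.2 by rewrite /d1 /d2 /e1 /e2; lra.
have := DE v; have := DE w.
move: (e1 * w.1 + _) (d1 * w.1 + _) (e1 * v.1 + _) (d1 * v.1 + _) w3 w4 v3 v4.
move=> a b a' b' a0 ba b'0 ab' h h'.
have [DltE|EleD] := ltP D E.
  have : D * a' < E * b' by apply: ltr_pM => //; nra.
  by rewrite h' ltxx.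
have : E * b < D * a by nra.
by rewrite h ltxx.
Qed.

Lemma maxsetP c x i :
  reflect (forall j, monval p c x j <= monval p c x i) (i \in Defs.maxset p setT c x).
Proof.
rewrite !inE /=; apply: (iffP forall_inP) => h j; last by move=> _.
by apply: h; rewrite inE.
Qed.

Lemma monval_maxset W c x i j :
  i \in Defs.maxset p W c x -> j \in Defs.maxset p W c x -> monval p c x i = monval p c x j.
Proof.
rewrite !inE => /andP[iW /forall_inP hi] /andP[jW /forall_inP hj].
by apply: le_anti; rewrite hi // hj.
Qed.

(** Moving [x] slightly in the direction [u] breaks the ties in favour of [i] and keeps the strict
    inequalities. *)
Lemma is_vert_subdiv c x i :
  is_vert R p (Defs.maxset p setT c x) i -> i \in subdiv_verts p c.
Proof.
move=> [iS [u hu]]; rewrite inE; apply/asboolP.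
(* The values 1 and 0 at [j = i] are placeholders that satisfy the hypotheses of [exists_small]. *)
pose g j := if j == i then 1 else monval p c x i - monval p c x j.
pose d j := if j == i then 0 else dotp u (p j) - dotp u (p i).
have [j|j|e e0 he] := @exists_small R _ g d.
- by rewrite /g; case: ifP => // _; rewrite subr_ge0; move/maxsetP: iS.
- rewrite /g /d; case: ifP => [_ /eqP|/negbT ji /eqP]; first by rewrite oner_eq0.
  rewrite subr_eq0 => /eqP e; rewrite subr_lt0; apply: hu => //.
  by apply/maxsetP => k; rewrite -e; move/maxsetP: iS.
exists (x.1 + e * u.1, x.2 + e * u.2) => j ji.
by have := he j; rewrite /g /d (negPf ji) /monval /dotp /=; lra.
Qed.

(** The cones spanned by the two edge directions at the four corners cover the plane; as (1, t) is
    parallel to no edge, it is interior to one of them. *)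
Lemma parallelogram_corner (t : R) V :
  (forall i j, py i - py j = t * (px i - px j) -> px i = px j) ->
  (forall i j k, i \in V -> j \in V -> k \in V -> i != j -> i != k -> j != k ->
     cross (p i) (p j) (p k) != 0) ->
  is_parallelogram p V ->
  exists v q r (a b : R),
    [/\ [/\ v \in V, q \in V & r \in V], 0 < a /\ 0 < b,
        a * (px v - px q) + b * (px v - px r) = 1,
        a * (py v - py q) + b * (py v - py r) = t &
        (px v - px q) * (py v - py r) != (py v - py q) * (px v - px r)].
Proof.
move=> gen ncol /andP[_ /exists_inP[A AV /exists_inP[B BV /exists_inP[D DV]]]].
move=> /exists_inP[E EV] /and5P[AB _ AE _ /and4P[BE _ /eqP h1 /eqP h2]].
have {h1} D1 : px D = px B + px E - px A.
  by have := congr1 (fun z => z%:~R : R) h1; rewrite /= !rmorphD /=; lra.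
have {h2} D2 : py D = py B + py E - py A.
  by have := congr1 (fun z => z%:~R : R) h2; rewrite /= !rmorphD /=; lra.
have := ncol A B E AV BV EV AB AE BE; rewrite -(intr_eq0 R) crossR.
pose u1 := px B - px A; pose u2 := py B - py A.
pose w1 := px E - px A; pose w2 := py E - py A.
rewrite -/u1 -/u2 -/w1 -/w2 => k0.
(* Cramer's rule for (1, t) in the basis of the edges [B - A] and [E - A]; a zero coefficient would
   make (1, t) parallel to an edge. *)
have a0 : (w2 - t * w1) / (u1 * w2 - u2 * w1) != 0.
  rewrite mulf_neq0 ?invr_eq0 //; apply: contraNneq k0 => /subr0_eq e.
  have w10 : w1 = 0 by rewrite /w1 (gen E A) ?subrr.
  by rewrite e w10 !mulr0 subr0.
have b0 : (t * u1 - u2) / (u1 * w2 - u2 * w1) != 0.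
  rewrite mulf_neq0 ?invr_eq0 //; apply: contraNneq k0 => /subr0_eq e.
  have u10 : u1 = 0 by rewrite /u1 (gen B A) ?subrr.
  by rewrite -e u10 mulr0 !mul0r subr0.
have e1 : (w2 - t * w1) / (u1 * w2 - u2 * w1) * u1
          + (t * u1 - u2) / (u1 * w2 - u2 * w1) * w1 = 1 by field.
have e2 : (w2 - t * w1) / (u1 * w2 - u2 * w1) * u2
          + (t * u1 - u2) / (u1 * w2 - u2 * w1) * w2 = t by field.
move: a0 b0 e1 e2; set a := (w2 - _) / _; set b := (_ - u2) / _; move: a b => a b.
have eqs : [/\ px B = px A + u1, py B = py A + u2, px E = px A + w1 & py E = py A + w2].
  by rewrite /u1 /u2 /w1 /w2; split; ring.
move: eqs D1 D2 k0 => [B1 B2 E1 E2]; rewrite B1 B2 E1 E2.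
move=> D1 D2 k0; rewrite 2!neq_lt => /orP[a0|a0] /orP[b0|b0] e1 e2.
(* The signs of [a] and [b] select the corner: changing one sign moves [v] along the corresponding
   edge. *)
- exists A, B, E, (- a), (- b); rewrite B1 B2 E1 E2 !oppr_gt0; split=> //.
  + by rewrite -e1; ring.
  + by rewrite -e2; ring.
  by rewrite -subr_eq0; apply: etrans k0; congr (_ != 0); ring.
- exists E, D, A, (- a), b; rewrite D1 D2 E1 E2 !oppr_gt0; split=> //.
  + by rewrite -e1; ring.
  + by rewrite -e2; ring.
  by rewrite -subr_eq0 -oppr_eq0; apply: etrans k0; congr (_ != 0); ring.
- exists B, A, D, a, (- b); rewrite D1 D2 B1 B2 !oppr_gt0; split=> //.
  + by rewrite -e1; ring.
  + by rewrite -e2; ring.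
  by rewrite -subr_eq0 -oppr_eq0; apply: etrans k0; congr (_ != 0); ring.
- exists D, E, B, a, b; rewrite D1 D2 B1 B2 E1 E2; split=> //.
  + by rewrite -e1; ring.
  + by rewrite -e2; ring.
  by rewrite -subr_eq0; apply: etrans k0; congr (_ != 0); ring.
Qed.

(* The hypotheses say that the concave lift of the subdivision lies below the
   plane of the cell dual to [x'] and touches it at [v]. *)
Lemma corner_lt c x x' (t a b : R) v q r :
  0 < a -> 0 < b ->
  a * (px v - px q) + b * (px v - px r) = 1 ->
  a * (py v - py q) + b * (py v - py r) = t ->
  (px v - px q) * (py v - py r) != (py v - py q) * (px v - px r) ->
  v \in Defs.maxset p setT c x -> q \in Defs.maxset p setT c x -> r \in Defs.maxset p setT c x ->
  v \in Defs.maxset p setT c x' -> x <> x' ->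
  x.1 + t * x.2 < x'.1 + t * x'.2.
Proof.
move=> a0 b0 e1 e2 ncr vx qx rx /maxsetP vx' xx'.
have := monval_maxset vx qx; have := monval_maxset vx rx; have := vx' q; have := vx' r.
rewrite /monval /dotp => h1 h2 h3 h4; rewrite ltNge; apply/negP => hle; apply: xx'.
move: ncr e1 e2 {vx qx rx vx'}.
pose q1 := px v - px q; pose q2 := py v - py q.
pose r1 := px v - px r; pose r2 := py v - py r.
rewrite -/q1 -/q2 -/r1 -/r2 => ncr e1 e2.
pose d1 := x'.1 - x.1; pose d2 := x'.2 - x.2.
(* At [x] the monomials of [v], [q], [r] tie, and at [x'] that of [v] is maximal, so moving from [x]
   to [x'] favours [v]. *)
have hq : 0 <= q1 * d1 + q2 * d2 by rewrite /q1 /q2 /d1 /d2; lra.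
have hr : 0 <= r1 * d1 + r2 * d2 by rewrite /r1 /r2 /d1 /d2; lra.
have hle' : a * (q1 * d1 + q2 * d2) + b * (r1 * d1 + r2 * d2) <= 0.
  have -> : a * (q1 * d1 + q2 * d2) + b * (r1 * d1 + r2 * d2) = d1 + t * d2.
    by rewrite -e2 -[X in _ = X + _]mul1r -e1; ring.
  by rewrite /d1 /d2; lra.
(* A positive combination of two nonnegative numbers is at most 0, so both vanish; the edges being
   independent, [x' = x]. *)
have q0 : q1 * d1 + q2 * d2 = 0 by apply/le_anti; rewrite hq andbT; nra.
have r0 : r1 * d1 + r2 * d2 = 0 by apply/le_anti; rewrite hr andbT; nra.
have k0 : q1 * r2 - q2 * r1 != 0 by rewrite subr_eq0.
have d10 : d1 = 0.
  apply: (mulfI k0); rewrite mulr0.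
  have -> : (q1 * r2 - q2 * r1) * d1 = r2 * (q1 * d1 + q2 * d2) - q2 * (r1 * d1 + r2 * d2) by ring.
  by rewrite q0 r0; ring.
have d20 : d2 = 0.
  apply: (mulfI k0); rewrite mulr0.
  have -> : (q1 * r2 - q2 * r1) * d2 = q1 * (r1 * d1 + r2 * d2) - r1 * (q1 * d1 + q2 * d2) by ring.
  by rewrite q0 r0; ring.
case: x x' @d1 @d2 d10 d20 {h1 h2 h3 h4 hle hq hr hle' q0 r0} => [x1 x2] [x1' x2'] /=.
by move=> /subr0_eq -> /subr0_eq ->.
Qed.

End Cells.

(** * The linear system attached to the subdivision *)

Section Rank.
Variables (R : realFieldType) (n : nat) (p : 'I_n -> int * int) (c : 'I_n -> R).
Implicit Types (V W P Z : {set 'I_n}) (w : 'rV[R]_n).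

Notation px i := ((p i).1%:~R : R).
Notation py i := ((p i).2%:~R : R).
Notation polys := (subdiv_polys p c).
Notation verts := (subdiv_verts p c).

Lemma polys_vert V : V \in polys ->
  exists x, forall i, i \in V <-> is_vert R p (Defs.maxset p setT c x) i.
Proof. by rewrite inE => /asboolP[x [_ h]]; exists x. Qed.

Lemma polys_sub_verts V : V \in polys -> V \subset verts.
Proof.
move=> /polys_vert[x hx]; apply/subsetP => i /hx; exact: is_vert_subdiv.
Qed.

Lemma polys_cross_neq0 V i j k : V \in polys -> i \in V -> j \in V -> k \in V ->
  i != j -> i != k -> j != k -> cross (p i) (p j) (p k) != 0.
Proof. by move=> /polys_vert[x hx] /hx hi /hx hj /hx hk; apply: verts_cross_neq0 hi hj hk. Qed.

Lemma parallelograms_excess : exists s,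
  [/\ uniq s, forall V, (V \in s) = (V \in polys) && is_parallelogram p V &
      excess set0 s = (\sum_(V <- s) (#|V| - 3))%N].
Proof.
(* [t] avoids all slopes between two of the points. A vertical pair gives the quotient 0 by
   convention, which merely excludes [t = 0]. *)
have [t tP] := exists_notin
  [seq (py ij.1 - py ij.2) / (px ij.1 - px ij.2) | ij : 'I_n * 'I_n].
have gen i j : py i - py j = t * (px i - px j) -> px i = px j.
  move=> e; apply/eqP; rewrite -subr_eq0; apply: contraNT tP => d0.
  by apply/mapP; exists (i, j); rewrite ?mem_enum //= e mulfK.
have [X hX] : exists X : {set 'I_n} -> R * R, forall V, V \in polys ->
    forall i, i \in V <-> is_vert R p (Defs.maxset p setT c (X V)) i.
  apply: (@fin_all_exists _ (fun=> (R * R)%type) (fun V x => V \in polys ->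
    forall i, i \in V <-> is_vert R p (Defs.maxset p setT c x) i)) => V.
  have [/polys_vert[x hx]|_] := boolP (V \in polys); first by exists x.
  by exists (0, 0).
have Xmax V i : V \in polys -> i \in V -> i \in Defs.maxset p setT c (X V).
  by move=> Vp /(hX V Vp)[].
pose h V := (X V).1 + t * (X V).2.
pose le_h V W := h V <= h W.
pose s := sort le_h (enum [pred V in polys | is_parallelogram p V]).
have sE V : (V \in s) = (V \in polys) && is_parallelogram p V.
  by rewrite mem_sort mem_enum.
have us : uniq s by rewrite sort_uniq enum_uniq.
exists s; split=> //; apply: (excess_fresh (h := h)) => //.
  rewrite -(@sorted_pairwise _ le_h); last by move=> V W V'; apply: le_trans.
  by apply: sort_sorted => V W; apply: le_total.
move=> V; rewrite sE => /andP[Vp Vpar]; split; first by case/andP: Vpar => /eqP.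
have [v [q [r [a [b [[vV qV rV] [a0 b0] e1 e2 k0]]]]]] :=
  parallelogram_corner gen (fun i j k => @polys_cross_neq0 V i j k Vp) Vpar.
exists v; split; rewrite ?inE // => W; rewrite sE => /andP[Wp _] WV vW.
apply: (corner_lt a0 b0 e1 e2 k0); try exact: Xmax.
(* Cells with the same dual point have the same vertices, hence coincide. *)
move=> e; case/eqP: WV; apply/setP => i.
by apply/idP/idP => [/(hX W Wp)|/(hX V Vp)]; [rewrite -e => /(hX V Vp)|rewrite e => /(hX W Wp)].
Qed.

(* The linear equations satisfied by the differences of vectors inducing the
   subdivision. *)
Definition cellwise_affine w :=
  (forall i, i \notin verts -> w 0 i = 0) /\
  (forall V, V \in polys -> exists A B : R, forall i j, i \in V -> j \in V ->
     w 0 i - w 0 j = A * (px i - px j) + B * (py i - py j)).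

Lemma cellwise_affineD w1 w2 :
  cellwise_affine w1 -> cellwise_affine w2 -> cellwise_affine (w1 + w2).
Proof.
move=> [z1 h1] [z2 h2]; split=> [i iV|V Vp]; first by rewrite mxE z1 ?z2 ?addr0.
have [A1 [B1 e1]] := h1 V Vp; have [A2 [B2 e2]] := h2 V Vp.
exists (A1 + A2), (B1 + B2) => i j iV jV; rewrite !mxE.
by move: (e1 i j iV jV) (e2 i j iV jV); lra.
Qed.

Lemma cellwise_affineZ (a : R) w : cellwise_affine w -> cellwise_affine (a *: w).
Proof.
move=> [z h]; split=> [i iV|V Vp]; first by rewrite mxE z ?mulr0.
have [A [B e]] := h V Vp; exists (a * A), (a * B) => i j iV jV; rewrite !mxE.
by rewrite -mulrBr (e i j iV jV); ring.
Qed.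

Lemma cellwise_affine_row_span m (M : 'M_(m, n)) w :
  (forall i, cellwise_affine (row i M)) -> (w <= M)%MS -> cellwise_affine w.
Proof.
move=> h /submxP[a ->]; rewrite mulmx_sum_row.
apply: (big_ind cellwise_affine); last by move=> i _; apply: cellwise_affineZ.
  by split=> [i _|V _]; [rewrite mxE|exists 0, 0 => i j _ _; rewrite !mxE; ring].
exact: cellwise_affineD.
Qed.

(** At the point [x] dual to [V] all monomials of vertices of [V] tie, so on [V] the coefficients
    are affine with gradient [- x]. *)
Lemma cellwise_affine_same v : same_subdiv_vectors p c v -> cellwise_affine v.
Proof.
move=> [c' [hc' ->]]; split=> [i iV|V Vp]; first by rewrite mxE (negPf iV).
have /subsetP Vv := polys_sub_verts Vp.
have [x [_ hx]] : cell_polygon p verts c' V.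
  by apply/hc'; move: Vp; rewrite inE => /asboolP.
exists (- x.1), (- x.2) => i j iV jV; rewrite !mxE !Vv //.
have /hx[iS _] := iV; have /hx[jS _] := jV.
by have := monval_maxset iS jS; rewrite /monval /dotp; lra.
Qed.

(** An affine function vanishing at three non-collinear points is zero. *)
Lemma cellwise_affine_zeros w V : cellwise_affine w -> V \in polys ->
  (3 <= #|V :&: [set i | w 0%R i == 0%R]|)%N -> V \subset [set i | w 0 i == 0].
Proof.
move=> [_ hw] Vp /card_geqP[s [us ss hs]].
case: s us ss hs => [|i [|j [|k [|? ?]]]] // us _ hs.
move: us; rewrite /= !inE negb_or andbT => /andP[/andP[ij ik] jk].
have [A [B hAB]] := hw V Vp.
have mem l : l \in [:: i; j; k] -> l \in V /\ w 0 l = 0.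
  by move=> /hs; rewrite !inE => /andP[-> /eqP].
have [iV wi] := mem i (mem_head _ _).
have [jV wj] : j \in V /\ w 0 j = 0 by apply: mem; rewrite !inE eqxx orbT.
have [kV wk] : k \in V /\ w 0 k = 0 by apply: mem; rewrite !inE eqxx !orbT.
have := polys_cross_neq0 Vp iV jV kV ij ik jk; rewrite -(intr_eq0 R) crossR => k0.
have := hAB j i jV iV; have := hAB k i kV iV; rewrite wi wj wk subrr => e1 e2.
have A0 : A = 0.
  apply: (mulfI k0); rewrite mulr0.
  transitivity ((py k - py i) * (A * (px j - px i) + B * (py j - py i))
    - (py j - py i) * (A * (px k - px i) + B * (py k - py i))); first by ring.
  by rewrite -e1 -e2 !mulr0 subrr.
have B0 : B = 0.
  apply: (mulfI k0); rewrite mulr0.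
  transitivity ((px j - px i) * (A * (px k - px i) + B * (py k - py i))
    - (px k - px i) * (A * (px j - px i) + B * (py j - py i))); first by ring.
  by rewrite -e1 -e2 !mulr0 subrr.
apply/subsetP => l lV; have := hAB l i lV iV.
by rewrite wi A0 B0 !mul0r addr0 subr0 inE => ->.
Qed.

(** A vector of the span that vanishes on the vertices outside [P] vanishes off [P], hence on [P]
    too. So the coordinates in [verts :\: P] determine it; the remaining 1 is the quotient by
    constants. *)
Lemma trop_rank_le P : P \subset verts ->
  (forall Z, {in polys, forall V, 3 <= #|V :&: Z| -> V \subset Z}%N ->
     ~: P \subset Z -> P \subset Z) ->
  trop_rank p c <= #|verts|%:Z - 1 - #|P|%:Z.
Proof.
move=> Pv hP.
have cQ : (#|verts :\: P| + #|P| = #|verts|)%N.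
  by rewrite addnC -[in RHS](cardsID P verts) (setIidPr Pv).
rewrite /trop_rank /dim_mod; set r := (X in X%:Z - 1).
suff : (r <= #|verts :\: P|)%N.
  by rewrite -cQ PoszD -lez_nat; move: (r%:Z) (Posz _) (Posz _) => x y z; lra.
apply/bigmax_leqP => k /asboolP[m [vs [hvs <-]]].
apply: mxrank_le_coords => w hw wQ.
have aff : cellwise_affine w.
  apply: cellwise_affine_row_span hw => i.
  rewrite -(splitK i); case: (split i) => j /=; rewrite ?rowKu ?rowKd.
    have -> : row j (\matrix_(j < m) (vs (lift ord0 j) - vs ord0)) =
        vs (lift ord0 j) + (-1) *: vs ord0 by rewrite rowK scaleN1r.
    by apply: cellwise_affineD; [|apply: cellwise_affineZ]; apply: cellwise_affine_same.
  (* The last row, the constant vector, is affine with zero gradient. *)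
  split=> [l lV|V Vp]; first by rewrite !mxE (negPf lV).
  have /subsetP Vv := polys_sub_verts Vp.
  by exists 0, 0 => l l' lV l'V; rewrite !mxE !Vv // !mul0r subrr addr0.
have z i : i \in ~: P -> w 0 i = 0.
  rewrite inE => iP; have [iv|iv] := boolP (i \in verts).
    by apply: wQ; rewrite inE iP.
  by case: aff => ->.
have /subsetP zP : P \subset [set i | w 0 i == 0].
  apply: hP => [V Vp|]; first exact: cellwise_affine_zeros.
  by apply/subsetP => i /z; rewrite inE => ->.
apply/rowP => i; rewrite [RHS]mxE.
have [/zP|iP] := boolP (i \in P); first by rewrite inE => /eqP.
by apply: z; rewrite inE.
Qed.

End Rank.

(** * Assembling the bound *)

Theorem mainTheorem5 (R : realFieldType) (n : nat) (p : 'I_n -> int * int)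
    (c : 'I_n -> R) (p_inj : injective p) (ds : seq {set 'I_n}) :
  uniq ds ->
  (forall V, (V \in ds) = (V \in subdiv_polys p c) && ~~ tri_or_par p V) ->
  trop_rank p c <=
    (#|subdiv_verts p c|%:Z - 1
     - \sum_(V in subdiv_polys p c | tri_or_par p V) (#|V|%:Z - 3)
     - \sum_(i < size ds)
         (#|nth set0 ds i|%:Z
          - (maxn 3 #|nth set0 ds i :&:
               ((\bigcup_(V in subdiv_polys p c | tri_or_par p V) V)
                :|: \bigcup_(j < i) nth set0 ds j)|)%:Z)).

Proof.
move=> uds dsE; have [ps [ups psE psX]] := parallelograms_excess p c.
pose ts := enum [pred V in subdiv_polys p c | #|V| == 3].
have rsE V : (V \in ps ++ ts) = (V \in subdiv_polys p c) && tri_or_par p V.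
  have tsE : (V \in ts) = (V \in subdiv_polys p c) && (#|V| == 3) by rewrite mem_enum.
  by rewrite mem_cat psE tsE -andb_orr orbC.
(* Sorted parallelograms come first, so that each yields its pivot; then the triangles, then the
   other polygons in the given order. *)
have [P [_ Pcov cP hP]] := excess_pivots set0 ((ps ++ ts) ++ ds).
have Ppoly V : V \in (ps ++ ts) ++ ds -> V \in subdiv_polys p c.
  by rewrite mem_cat rsE dsE => /orP[] /andP[].
have polyP V : V \in subdiv_polys p c -> V \in (ps ++ ts) ++ ds.
  by move=> Vp; rewrite mem_cat rsE dsE Vp orbN.
have Pv : P \subset subdiv_verts p c.
  apply: (subset_trans Pcov); rewrite bigcup_seq; apply/bigcupsP => V /Ppoly.
  exact: polys_sub_verts.
apply: le_trans (trop_rank_le Pv _) _ => [Z hZ|].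
  by apply: hP => V /Ppoly; apply: hZ.
have covE : \bigcup_(V <- ps ++ ts) V =
    \bigcup_(V in subdiv_polys p c | tri_or_par p V) V.
  by rewrite bigcup_seq; apply: eq_bigl => V; rewrite rsE.
have tpE : \sum_(V in subdiv_polys p c | tri_or_par p V) (#|V|%:Z - 3) =
    (excess set0 ps)%:Z.
  (* Each triangle contributes 3 - 3 = 0, so only the parallelograms remain in the sum. *)
  rewrite psX (big_morph Posz PoszD (erefl 0%:Z)) (bigID (is_parallelogram p)) /=.
  rewrite [X in _ + X]big1 => [|V /andP[/andP[_ /orP[/eqP->|->]]] //].
  rewrite addr0 big_uniq //=; apply: eq_big => [V|V /andP[_ /andP[/eqP-> _]] //].
  by rewrite psE /tri_or_par; case: (is_parallelogram p V); rewrite ?orbT ?andbT ?andbF.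
have dsX : \sum_(i < size ds) (#|nth set0 ds i|%:Z
     - (maxn 3 #|nth set0 ds i :&:
          ((\bigcup_(V in subdiv_polys p c | tri_or_par p V) V)
            :|: \bigcup_(j < i) nth set0 ds j)|)%:Z) <=
    (excess (set0 :|: \bigcup_(V <- ps ++ ts) V) ds)%:Z.
  rewrite set0U covE excess_nth (big_morph Posz PoszD (erefl 0%:Z)).
  (* Truncated subtraction is at least the integer difference. *)
  apply: ler_sum => i _; set m := maxn _ _; lia.
have PX : (excess set0 ps)%:Z + (excess (set0 :|: \bigcup_(V <- ps ++ ts) V) ds)%:Z <= #|P|%:Z.
  by rewrite cP !excess_cat -PoszD lez_nat leq_add2r leq_addr.
have := lerD (lexx (excess set0 ps)%:Z) dsX => /le_trans/(_ PX) le_P.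
by rewrite tpE -[X in _ <= X]addrA -opprD lerD2l lerN2.
Qed.
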